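(* Let $G$ be a locally finite (weighted) graph whose vertex set $V(G)$ is linearly ordered, and let $n\ge1$. For all vertices $(u_1,\dots,u_n)$, $(v_1,\dots,v_n)$ of $\Lambda^nG$, $$c(\Lambda^nG,(u_1,\dots,u_n)\to(v_1,\dots,v_n))=\det\big(c(G,u_i\to v_j)\big)_{1\le i,j\le n}.$$
   Context: Weights lie in a commutative ring $Z$ (unweighted: $Z=\mathbb{Z}$, $w\equiv1$). $\Lambda^nG$ is the directed weighted graph with vertex set $\{(v_1,\dots,v_n)\in V(G)^n: v_1<\dots<v_n\}$; for such a tuple $A$ write $v_i(A)$ for its $i$-th entry and $\Pr_i(A)$ for the $(n-1)$-tuple obtained by deleting the $i$-th entry. The edges from $A$ to $B$ correspond to the pairs $(i,e)$ with $i\in\{1,\dots,n\}$ and $e\in E(G)$ such that there is $j$ with $\Pr_i(A)=\Pr_j(B)$ and $e$ an edge of $G$ from $v_i(A)$ to $v_j(B)$ (undirected edges count in either direction); such an edge has weight $(-1)^{j-i}w(e)$. A walk of length $n$ from $u$ to $v$ is a sequence of vertices $u=x_0,\dots,x_n=v$ with edges $e_k$ from $x_{k-1}$ to $x_k$; its weight is $\prod w(e_k)$; $c_n(G,u\to v)$ is the sum of the weights of such walks ($c_0=\delta_{uv}$) and $c(G,u\to v)=\sum_nc_n(G,u\to v)t^n/n!$, an element of the algebra of formal exponential series over $Z$ (with its usual product). *)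

(* Defs.v *)
(* MathComp, with the classical sets and finitely supported sums of
   mathcomp-classical. *)
From HB Require Import structures.
From mathcomp Require Import all_boot all_order all_algebra.
From mathcomp Require Import all_classical.

Set Implicit Arguments.
Unset Strict Implicit.
Unset Printing Implicit Defensive.

Import Order.TTheory GRing.Theory.
Local Open Scope classical_set_scope.
Local Open Scope ring_scope.

(* A formal exponential series \sum_n a_n t^n/n! is the sequence of its
   coefficients a_n. The symbols t^n/n! are formal (n! need not be invertible
   in R): (t^k/k!) * (t^l/l!) = 'C(k + l, k) t^(k+l)/(k+l)!. The alias keeps
   this product apart from the pointwise one carried by nat -> R. *)
Definition expseries (R : comPzRingType) : Type := nat -> R.

HB.instance Definition _ (R : comPzRingType) :=
  GRing.Zmodule.copy (expseries R) (nat -> R).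

Section ExpSeries.
Variable R : comPzRingType.
Implicit Types a b c : expseries R.

Definition expseries_one : expseries R := fun n => (n == 0)%:R.

Definition expseries_mul a b : expseries R :=
  fun n => \sum_(k < n.+1) (a k * b (n - k)%N) *+ 'C(n, k).

Definition expseries_deriv a : expseries R := fun n => a n.+1.

Local Notation mul := expseries_mul.
Local Notation D := expseries_deriv.

Lemma expseries_mul0 a b : mul a b 0%N = a 0%N * b 0%N.
Proof. by rewrite /mul big_ord1 bin0 mulr1n. Qed.

Lemma expseries_mulS a b n : mul a b n.+1 = mul (D a) b n + mul a (D b) n.
Proof.
rewrite /mul big_ord_recl /= bin0 mulr1n subn0 addrC.
under eq_bigr => k _ do rewrite /bump /= add1n subSS binS addnC mulrnDr.
rewrite big_split /= -addrA; congr (_ + _).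
rewrite big_ord_recr /= bin_small // mulr0n addr0 addrC.
rewrite [RHS]big_ord_recl /= bin0 mulr1n subn0; congr (_ + _).
by apply: eq_bigr => k _; rewrite /bump /= add1n /D -subSn ?subSS.
Qed.

Lemma expseries_mulC : commutative mul.
Proof.
move=> a b; apply/funext => n; elim: n a b => [|n IH] a b.
  by rewrite !expseries_mul0 mulrC.
by rewrite !expseries_mulS addrC; congr (_ + _); exact: IH.
Qed.

Lemma expseries_mulDl : left_distributive mul +%R.
Proof.
move=> a b c; apply/funext => n.
rewrite /mul [RHS]/GRing.add /= -big_split /=; apply: eq_bigr => k _.
by rewrite -mulrnDl -mulrDl.
Qed.

Lemma expseries_mulA : associative mul.
Proof.
move=> a b c; apply/funext => n; elim: n a b c => [|n IH] a b c.
  by rewrite !expseries_mul0 mulrA.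
have DM x y : D (mul x y) = mul (D x) y + mul x (D y).
  by apply/funext => m; rewrite /D expseries_mulS.
have DMr x y z : mul x (y + z) = mul x y + mul x z.
  by rewrite expseries_mulC expseries_mulDl !(expseries_mulC x).
rewrite !expseries_mulS !DM DMr expseries_mulDl.
have addE (x y : expseries R) m : (x + y) m = x m + y m by [].
by rewrite !addE !IH addrA.
Qed.

Lemma expseries_mul1 : left_id expseries_one mul.
Proof.
move=> a; apply/funext => n.
rewrite /mul big_ord_recl big1 => [|k _]; last by rewrite /= mul0r mul0rn.
by rewrite /= mul1r bin0 mulr1n subn0 addr0.
Qed.

HB.instance Definition _ := GRing.Zmodule_isComPzRing.Build (expseries R)
  expseries_mulA expseries_mulC expseries_mul1 expseries_mulDl.

End ExpSeries.

(* Loops and parallel edges are allowed, and each edge is either directed or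
   undirected; the order of the endpoints of an undirected edge is
   irrelevant. *)
Record wgraph (R : Type) (V : choiceType) := WGraph {
  edge : choiceType;
  source : edge -> V;
  target : edge -> V;
  directed : pred edge;
  weight : edge -> R }.

Section Walks.
Variables (R : comPzRingType) (V : choiceType) (G : wgraph R V).

Definition edge_from (e : edge G) (u v : V) : bool :=
  ((source e == u) && (target e == v)) ||
  [&& ~~ directed e, source e == v & target e == u].

Definition locally_finite : Prop :=
  forall v : V, finite_set [set e : edge G | source e = v \/ target e = v].

Definition walk (n : nat) (u v : V) : set (n.+1.-tuple V * n.-tuple (edge G)) :=
  [set p | [/\ tnth p.1 ord0 = u, tnth p.1 ord_max = v &
    forall k : 'I_n, edge_from (tnth p.2 k)
      (tnth p.1 (widen_ord (leqnSn n) k)) (tnth p.1 (lift ord0 k))]].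

Definition walk_weight (n : nat) (p : n.+1.-tuple V * n.-tuple (edge G)) : R :=
  \prod_(k < n) weight (tnth p.2 k).

(* Such a sum over a set has the junk value 0 when infinitely many terms are
   nonzero; there are finitely many walks of given length between two vertices
   as soon as each vertex has finitely many outgoing edges. *)
Definition walk_count (n : nat) (u v : V) : R :=
  \sum_(p \in @walk n u v) walk_weight p.

Definition walk_series (u v : V) : expseries R := fun n => walk_count n u v.

End Walks.

Definition ext_vertex (d : Order.disp_t) (V : orderType d) (n : nat) : Type :=
  {A : n.-tuple V | sorted <%O A}.

HB.instance Definition _ (d : Order.disp_t) (V : orderType d) (n : nat) :=
  Choice.on (ext_vertex V n).

Section ExteriorPower.
Variables (R : comPzRingType) (d : Order.disp_t) (V : orderType d).
Variables (G : wgraph R V) (n : nat).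
Local Notation vertex := (ext_vertex V n).

Definition entry (i : 'I_n) (A : vertex) : V := tnth (val A) i.

Definition del_entry (i : 'I_n) (A : vertex) : n.-1.-tuple V :=
  [tuple entry (lift i k) A | k < n.-1].

Definition ext_move (A B : vertex) (i : 'I_n) (e : edge G) (j : 'I_n) : bool :=
  (del_entry i A == del_entry j B) && edge_from e (entry i A) (entry j B).

(* (A, B, i, e) stands for the edge (i, e) from A to B. *)
Definition is_ext_edge (x : vertex * vertex * 'I_n * edge G) : bool :=
  let: (A, B, i, e) := x in [exists j, ext_move A B i e j].

Definition ext_edge : Type := {x | is_ext_edge x}.

HB.instance Definition _ := Choice.on ext_edge.

(* The index j is determined by A, B and i (ext_move_inj), and
   (-1) ^+ (i + j) is the sign (-1)^(j - i); the default 0 is never used. *)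
Definition ext_weight (x : ext_edge) : R :=
  let: (A, B, i, e) := val x in
  if [pick j | ext_move A B i e j] is Some j
  then (-1) ^+ (i + j) * weight e else 0.

Definition ext_power : wgraph R vertex :=
  {| edge := ext_edge;
     source := fun x => (val x).1.1.1;
     target := fun x => (val x).1.1.2;
     directed := xpredT;
     weight := ext_weight |}.

Lemma ext_move_inj A B i e j k :
  ext_move A B i e j -> ext_move A B i e k -> j = k.
Proof.
move=> /andP[/eqP Ej _] /andP[/eqP Ek _]; apply/eqP; apply: contraT => njk.
have uB : uniq (val B) by apply: lt_sorted_uniq; exact: (valP B).
have /unlift_some[l kE _] := njk.
have := congr1 (fun t => tnth t l) (etrans (esym Ej) Ek).
rewrite !tnth_mktuple -kE /entry => /(tuple_uniqP _ uB) Ekl.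
by have := neq_lift k l; rewrite -Ekl eqxx.
Qed.

Lemma ext_weightE (x : ext_edge) (A B : vertex) (i j : 'I_n) (e : edge G) :
  val x = (A, B, i, e) -> ext_move A B i e j ->
  ext_weight x = (-1) ^+ (i + j) * weight e.
Proof.
rewrite /ext_weight => -> mj; case: pickP => [k mk|/(_ j)]; last by rewrite mj.
by rewrite (ext_move_inj mk mj).
Qed.

End ExteriorPower.

(* Main.v *)
(* Split off the first step of a walk: writing c' for the formal derivative,
     c(G, u -> v)' = \sum_e w(e) c(G, u' -> v),
   over the edges e from u to u'. As the derivative is a derivation,
   differentiating the determinant row by row gives the sum, over the indices i
   and the edges e from u_i to some w, of w(e) times the determinant in which
   u_i is replaced by w. If w is another entry of the tuple, two rows agree and
   the term vanishes; otherwise moving w to its place j in the sorted tuple B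
   costs the sign (-1)^(i + j), and the term belongs to the edge (i, e) to B of
   the exterior power. So both sides satisfy the same first-order recursion, and
   their constant terms agree. *)
Require Import Defs.
From HB Require Import structures.
From mathcomp Require Import all_boot all_order all_algebra.
From mathcomp Require Import all_classical.
Local Open Scope ring_scope.

Set Implicit Arguments.
Unset Strict Implicit.
Unset Printing Implicit Defensive.

Import Order.TTheory GRing.Theory.

(** * Constant series, constant term and formal derivative *)

Section Expseries.
Variable R : comPzRingType.
Implicit Types a b : expseries R.

Definition expseries_const (r : R) : expseries R :=
  fun n => if n is 0 then r else 0.

Lemma expseries_constM r a n : (expseries_const r * a) n = r * a n.
Proof.
rewrite /GRing.mul /= /expseries_mul big_ord_recl big1 => [|k _].
  by rewrite bin0 mulr1n subn0 addr0.
by rewrite /= mul0r mul0rn.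
Qed.

Lemma expseries_const_sign (k : nat) r :
  expseries_const ((-1) ^+ k * r) = (-1) ^+ k * expseries_const r.
Proof.
rewrite -signr_odd -[in RHS]signr_odd !mulr_sign.
by case: (odd k) => //; apply/funext => -[|n] //=; rewrite [RHS]oppr0.
Qed.

Lemma expseries_sumE (I : Type) (r : seq I) (P : pred I) (F : I -> expseries R)
  n : (\sum_(i <- r | P i) F i) n = \sum_(i <- r | P i) F i n.
Proof.
by rewrite (big_morph (fun a : expseries R => a n) (id1 := 0) (op1 := +%R)).
Qed.

(** Named so that it can be made a ring morphism: the constant term then commutes with
    determinants. *)
Definition expseries_coef0 a : R := a 0%N.

Fact expseries_coef0_zmod_morphism : zmod_morphism expseries_coef0.
Proof. by []. Qed.

Fact expseries_coef0_monoid_morphism : monoid_morphism expseries_coef0.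
Proof. by split=> // a b; exact: expseries_mul0. Qed.

HB.instance Definition _ := GRing.isZmodMorphism.Build _ _ expseries_coef0
  expseries_coef0_zmod_morphism.
HB.instance Definition _ := GRing.isMonoidMorphism.Build _ _ expseries_coef0
  expseries_coef0_monoid_morphism.

Fact expseries_deriv_zmod_morphism : zmod_morphism (@expseries_deriv R).
Proof. by []. Qed.

HB.instance Definition _ := GRing.isZmodMorphism.Build _ _ (@expseries_deriv R)
  expseries_deriv_zmod_morphism.

Lemma expseries_derivM a b :
  expseries_deriv (a * b) = expseries_deriv a * b + a * expseries_deriv b.
Proof. by apply/funext => n; exact: expseries_mulS. Qed.

End Expseries.

(** * Leibniz rule for products and determinants *)

Section Derivation.
Variables (A : comPzRingType) (D : {additive A -> A}).
Hypothesis DM : forall a b, D (a * b) = D a * b + a * D b.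

Lemma derivation1 : D 1 = 0.
Proof. by apply: (addIr (D 1)); rewrite add0r -{3}[1]mulr1 DM mulr1 mul1r. Qed.

Lemma derivation_prod n (F : 'I_n -> A) :
  D (\prod_i F i) = \sum_i \prod_k (if k == i then D (F k) else F k).
Proof.
elim: n F => [|n IH] F; first by rewrite !big_ord0 derivation1.
rewrite big_ord_recl DM IH [RHS]big_ord_recl; congr (_ + _).
  by rewrite [RHS]big_ord_recl.
by rewrite mulr_sumr; apply: eq_bigr => i _; rewrite [RHS]big_ord_recl.
Qed.

(** Each permutation term is a signed product with one factor per row, so the product rule applies
    to it; exchanging the sums over permutations and rows regroups the result by row. *)
Lemma derivation_det n (M : 'M[A]_n) :
  D (\det M) = \sum_i \det (\matrix_(k, l) if k == i then D (M k l) else M k l).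
Proof.
rewrite /determinant raddf_sum exchange_big; apply: eq_bigr => s _ /=.
rewrite !mulr_sign -mulr_sumr mulr_sign.
rewrite (fun_if D) raddfN derivation_prod.
by under [in RHS]eq_bigr => i _ do under eq_bigr => k _ do rewrite mxE.
Qed.

End Derivation.

(** * First-step recursion for walks in a graph *)

Lemma lift0_ord_max n : ord_max = lift ord0 (ord_max : 'I_n.+1).
Proof. exact: val_inj. Qed.

Section WalkRecursion.
Variables (R : comPzRingType) (V : choiceType) (G : wgraph R V).

Definition edge_out (u : V) (e : edge G) : bool :=
  (source e == u) || ~~ directed e && (target e == u).

Definition other_end (u : V) (e : edge G) : V :=
  if source e == u then target e else source e.

(** If [source e] is [u], the second disjunct of [edge_from] forces a loop at [u], which the first
    disjunct already covers; hence the end reached is a function of [u] and [e]. *)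
Lemma edge_fromE e u v : edge_from e u v = edge_out u e && (other_end u e == v).
Proof.
rewrite /edge_from /edge_out /other_end.
case: (eqVneq (source e) u) => [<-|_] /=; last by rewrite andbAC andbA.
case: (eqVneq (target e) v) => //= tv.
by apply/and3P => -[_ /eqP E F]; rewrite -E F in tv.
Qed.

(** Finiteness enters as an enumeration of the outgoing edges, so that the recursion applies both to
    a graph and to its exterior power. *)
Variable outs : V -> seq (edge G).
Hypothesis outs_uniq : forall u, uniq (outs u).
Hypothesis mem_outs : forall u, outs u =i edge_out u.

Fixpoint walks (n : nat) (u v : V) : seq (n.+1.-tuple V * n.-tuple (edge G)) :=
  if n is n'.+1 then
    [seq (cons_tuple u q.1, cons_tuple e q.2)
      | e <- outs u, q <- walks n' (other_end u e) v]
  else if u == v then [:: ([tuple u], [tuple])] else [::].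

Lemma walks_uniq n u v : uniq (walks n u v).
Proof.
elim: n u => [|n IH] u /=; first by case: ifP.
apply: allpairs_uniq_dep => //.
by move=> [e [a b]] [e' [a' b']] _ _ /= /(@pair_equal_spec _ _)[]
  /(congr1 val)[] /val_inj-> /(congr1 val)[] -> /val_inj->.
Qed.

(** Listing the walks turns [walk_count] into an ordinary finite sum, away from its junk value. *)
Lemma mem_walks n u v : [set` walks n u v]%classic = walk u v.
Proof.
apply/seteqP; split=> p.
  elim: n u p => [|n IH] u p /=.
    by case: eqP => //= uv; rewrite inE => /eqP->; split=> // -[].
  move=> /allpairsPdep[e [q [eu /IH[q0 qn qs] ->]]].
  move: eu; rewrite mem_outs => eu.
  split=> /=; first by rewrite tnth0.
    by rewrite lift0_ord_max tnthS.
  (* Index [ord0] is the prepended edge [e]; every other index is a step of the tail [q]. *)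
  move=> k; case: (unliftP ord0 k) => [k'|] ->; last first.
    have -> : widen_ord (leqnSn n.+1) ord0 = ord0 by exact: val_inj.
    by rewrite edge_fromE !tnth0 tnthS q0 eqxx andbT.
  have -> : widen_ord (leqnSn n.+1) (lift ord0 k') =
            lift ord0 (widen_ord (leqnSn n) k') by exact: val_inj.
  by rewrite !tnthS.
elim: n u p => [|n IH] u p /=.
  case: p => [a b] /= [a0 an _]; case: eqP => [uv|[]]; last first.
    by rewrite -a0 -an; congr tnth; exact: val_inj.
  rewrite inE; apply/eqP; congr pair; last exact: tuple0.
  by case/tupleP: a a0 {an} => x a; rewrite tnth0 (tuple0 a) => ->; exact: val_inj.
case: p => a b; case/tupleP: b => e b; case/tupleP: a => x a /= [].
rewrite tnth0 => -> {x} an ab; apply/allpairsPdep; exists e, (a, b).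
have := ab ord0.
have -> : widen_ord (leqnSn n.+1) ord0 = ord0 by exact: val_inj.
rewrite edge_fromE !tnth0 tnthS => /andP[eu /eqP ea].
split=> //; first by rewrite mem_outs.
apply: IH; split=> //=.
  by rewrite -an lift0_ord_max tnthS.
move=> k; have := ab (lift ord0 k); rewrite !tnthS.
have -> // : widen_ord (leqnSn n.+1) (lift ord0 k) =
            lift ord0 (widen_ord (leqnSn n) k) by exact: val_inj.
by rewrite tnthS.
Qed.

Lemma walk_series_out u v :
  expseries_deriv (walk_series G u v) =
  \sum_(e <- outs u) expseries_const (weight e) * walk_series G (other_end u e) v.
Proof.
have wE n x : walk_series G x v n = \sum_(p <- walks n x v) walk_weight p.
  by rewrite /walk_series /walk_count -mem_walks -fsbig_seq ?walks_uniq.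
apply/funext => n; rewrite expseries_sumE /expseries_deriv wE /=.
rewrite big_allpairs_dep; apply: eq_bigr => e _.
rewrite expseries_constM wE mulr_sumr; apply: eq_bigr => q _.
rewrite /walk_weight big_ord_recl tnth0; congr (_ * _).
by apply: eq_bigr => k _; rewrite tnthS.
Qed.

Lemma walk_series0 u v : walk_series G u v 0%N = (u == v)%:R.
Proof.
rewrite /walk_series /walk_count -mem_walks -fsbig_seq ?walks_uniq //=.
by case: eqP => _; rewrite ?big_seq1 ?big_nil // /walk_weight big_ord0.
Qed.

End WalkRecursion.

(** * Deletion and insertion in sorted tuples, and the related determinants *)

Section ExtVertices.
Variables (d : Order.disp_t) (V : orderType d) (n : nat).
Implicit Types A B : ext_vertex V n.

Lemma ext_vertex_uniq A : uniq (val A).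
Proof. by apply: lt_sorted_uniq; exact: (valP A). Qed.

Lemma entry_inj A : injective (fun i => entry i A).
Proof. by move=> i j; apply/tuple_uniqP; exact: ext_vertex_uniq. Qed.

Lemma ext_vertex_eq A B : val A =i val B -> A = B.
Proof.
move=> AB; do 2 apply: val_inj; exact: (lt_sorted_eq (valP A) (valP B)).
Qed.

Lemma mem_del_entry A i x :
  (x \in del_entry i A) = (x != entry i A) && (x \in val A).
Proof.
apply/tnthP/andP => [[k ->]|[xi /tnthP[k xk]]].
  rewrite tnth_mktuple mem_tnth; split=> //.
  by rewrite (inj_eq (@entry_inj A)) eq_sym neq_lift.
have /unlift_some[l kl _] : i != k by apply: contraNneq xi => ->; rewrite xk.
by exists l; rewrite tnth_mktuple -kl.
Qed.

Lemma mem_ext_vertex A i x :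
  (x \in val A) = (x == entry i A) || (x \in del_entry i A).
Proof. by rewrite mem_del_entry; case: eqVneq => //= ->; exact: mem_tnth. Qed.

Lemma del_entry_sorted A i : sorted <%O (del_entry i A).
Proof.
apply: (@homo_sorted _ _ _ (relpre val ltn)) => [k l kl|].
  rewrite /entry !(tnth_nth (entry i A)) lt_sorted_ltn_nth ?inE ?size_tuple //.
    by rewrite ltnNge leq_bump2 -ltnNge.
  exact: (valP A).
by rewrite -sorted_map val_enum_ord iota_ltn_sorted.
Qed.

(** [B] is obtained by sorting [w] together with the remaining entries, and [j] is the position
    where [w] lands. *)
Lemma ext_insert A i w : w \notin del_entry i A ->
  exists B j, del_entry i A = del_entry j B /\ entry j B = w.
Proof.
move=> wA; set s := sort <=%O (w :: del_entry i A).
(* The index [i] shows that [n] is positive, so adding one entry to [n.-1] gives back [n]. *)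
have n0 : (0 < n)%N by exact: leq_ltn_trans (ltn_ord i).
have sz : size s == n.
  rewrite size_sort; apply/eqP; rewrite -[RHS](prednK n0).
  exact: (congr1 S (size_tuple _)).
have us : uniq s.
  by rewrite sort_uniq /= wA (lt_sorted_uniq (del_entry_sorted A i)).
have ss : sorted <%O (Tuple sz) by rewrite /= lt_sorted_uniq_le us sort_le_sorted.
have /tnthP[j wj] : w \in Tuple sz by rewrite mem_sort mem_head.
exists (exist _ (Tuple sz) ss), j; split=> //.
apply: val_inj; apply: lt_sorted_eq; rewrite ?del_entry_sorted // => x.
rewrite [RHS]mem_del_entry /entry /= -wj mem_sort inE.
by case: eqVneq => //= ->; apply/negbTE.
Qed.

(** Expanding along row [i] on the left and row [j] on the right leaves the same minors, since the
    other rows come from the same tuple; only the cofactor signs differ. *)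
Lemma det_ext_move (S : comPzRingType) (f : V -> 'I_n -> S) A B (i j : 'I_n) :
  del_entry i A = del_entry j B ->
  \det (\matrix_(k, l) f (if k == i then entry j B else entry k A) l) =
  (-1) ^+ (i + j) * \det (\matrix_(k, l) f (entry k B) l).
Proof.
move=> AB; rewrite (expand_det_row _ i) (expand_det_row _ j) mulr_sumr.
apply: eq_bigr => l _; rewrite !mxE eqxx [RHS]mulrCA; congr (_ * _).
(* The exponent (i + j) + (j + l) becomes 2j + (i + l), and the even part drops out. *)
rewrite /cofactor [RHS]mulrA -exprD -addnA (addnA j) addnn addnCA [in RHS]exprD.
rewrite -[(-1) ^+ j.*2]signr_odd odd_double mul1r; congr (_ * \det _).
apply/matrixP => k m; rewrite !mxE eq_sym (negbTE (neq_lift _ _)).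
by congr f; have := congr1 (fun t => tnth t k) AB; rewrite !tnth_mktuple.
Qed.

Lemma det_delta (S : comPzRingType) A B :
  \det (\matrix_(k < n, l < n) (entry k A == entry l B)%:R) =
  (A == B)%:R :> S.
Proof.
case: eqVneq => [->|AB].
  rewrite -[RHS](det1 S n); congr (\det _); apply/matrixP => k l.
  by rewrite !mxE (inj_eq (@entry_inj B)).
(* Both tuples have [n] distinct entries, so if they differ, some entry of [A] is missing from [B];
   its row is zero. *)
have [k kB] : exists k, entry k A \notin val B.
  apply/existsP; apply: contraNT AB => /existsPn AB; apply/eqP/ext_vertex_eq.
  have sAB : {subset val A <= val B} by move=> _ /tnthP[k ->]; exact/negPn/AB.
  by have [] := uniq_min_size (ext_vertex_uniq A) sAB; rewrite ?size_tuple.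
rewrite (expand_det_row _ k) big1 // => l _; rewrite mxE.
by case: eqP kB => [->|]; rewrite ?mem_tnth ?mul0r.
Qed.

End ExtVertices.

(** * The same recursion for the determinant *)

Section ExtWalks.
Variables (R : comPzRingType) (d : Order.disp_t) (V : orderType d).
Variables (G : wgraph R V) (n : nat) (v : ext_vertex V n).
Variable outs : V -> seq (edge G).
Hypothesis outs_uniq : forall x, uniq (outs x).
Hypothesis mem_outs : forall x, outs x =i edge_out x.

Local Notation vertex := (ext_vertex V n).
Local Notation f := (fun x l => walk_series G x (entry l v)).

Definition det_series (A : vertex) : expseries R :=
  \det (\matrix_(k < n, l < n) walk_series G (entry k A) (entry l v)).

Definition det_series_at (A : vertex) (p : 'I_n * edge G) : expseries R :=
  \det (\matrix_(k < n, l < n) walk_series G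
    (if k == p.1 then other_end (entry p.1 A) p.2 else entry k A) (entry l v)).

(** Candidate steps, including those that land on another entry of [A] and so give no edge of the
    exterior power. *)
Definition moves (A : vertex) : seq ('I_n * edge G) :=
  [seq (i, e) | i <- enum 'I_n, e <- outs (entry i A)].

Lemma moves_uniq A : uniq (moves A).
Proof.
apply: allpairs_uniq_dep; rewrite ?enum_uniq // => -[i e] [i' e'] _ _ /=.
by case=> -> ->.
Qed.

Lemma mem_moves A i e : ((i, e) \in moves A) = edge_out (entry i A) e.
Proof.
apply/allpairsPdep/idP => [[i' [e' [_ + [-> ->]]]]|eA].
  by rewrite mem_outs.
by exists i, e; rewrite mem_enum mem_outs.
Qed.

Lemma det_series_deriv A :
  expseries_deriv (det_series A) =
  \sum_(p <- moves A) expseries_const (weight p.2) * det_series_at A p.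
Proof.
rewrite /det_series (derivation_det (@expseries_derivM R)).
rewrite big_allpairs_dep big_enum /=; apply: eq_bigr => i _.
(* Row [i] of the differentiated matrix is a sum over edges; expanding both sides along it makes the
   linearity in that row explicit. *)
under [RHS]eq_bigr => e _ do
  rewrite /det_series_at (expand_det_row _ i) mulr_sumr.
rewrite (expand_det_row _ i) exchange_big; apply: eq_bigr => l _ /=.
rewrite !mxE eqxx (walk_series_out outs_uniq mem_outs) mulr_suml.
apply: eq_bigr => e _; rewrite !mxE eqxx -mulrA; congr (_ * (_ * (_ * \det _))).
by apply/matrixP => k m; rewrite !mxE eq_sym (negbTE (neq_lift _ _)).
Qed.

Lemma det_series_at_collision A p :
  other_end (entry p.1 A) p.2 \in del_entry p.1 A -> det_series_at A p = 0.
Proof.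
move=> /tnthP[k]; rewrite tnth_mktuple => pk.
apply: (@determinant_alternate _ _ _ p.1 (lift p.1 k)); first exact: neq_lift.
by move=> l; rewrite !mxE eqxx eq_sym (negbTE (neq_lift _ _)) pk.
Qed.

Definition move_of (x : ext_edge G n) : 'I_n * edge G :=
  ((val x).1.2, (val x).2).

(** The witness [j] hidden in [is_ext_edge] fixes both the landing position and the sign of the
    weight. *)
Lemma ext_edgeP (x : ext_edge G n) :
  let A := @source _ _ (ext_power G n) x in
  let B := @target _ _ (ext_power G n) x in
  let p := move_of x in
  exists j, [/\ del_entry p.1 A = del_entry j B,
    edge_out (entry p.1 A) p.2, other_end (entry p.1 A) p.2 = entry j B &
    ext_weight x = (-1) ^+ (p.1 + j) * weight p.2].
Proof.
case: x => -[[[A B] i] e] Ax; have /existsP[j AB] := Ax; exists j.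
have /andP[/eqP dAB] := AB; rewrite edge_fromE => /andP[eA /eqP eB].
by split=> //; apply: ext_weightE AB.
Qed.

(** The target is recovered from the move: its entries are those left after the deletion, together
    with the end reached, and sorting determines it. *)
Lemma move_of_inj A :
  {in [pred x | @source _ _ (ext_power G n) x == A] &, injective move_of}.
Proof.
move=> x y; rewrite !inE => /eqP xA /eqP yA xy; apply: val_inj.
have [j [dB _ eB _]] := ext_edgeP x; have [j' [dB' _ eB' _]] := ext_edgeP y.
move: xA yA xy dB eB dB' eB'; rewrite /move_of.
case: x y => -[[[Ax B] i] e] _ [[[[Ay B'] i'] e'] _] /= -> -> [-> ->].
move=> dB eB dB' eB'; congr (_, _, _, _); apply: ext_vertex_eq => x.
by rewrite (mem_ext_vertex _ j) (mem_ext_vertex B' j') -dB -dB' -eB -eB'.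
Qed.

(** Surjectivity of [move_of] onto the moves without collision; the target comes from
    [ext_insert]. *)
Lemma ext_edge_of_move A p : p \in moves A ->
  other_end (entry p.1 A) p.2 \notin del_entry p.1 A ->
  exists2 x, @source _ _ (ext_power G n) x = A & move_of x = p.
Proof.
case: p => i e; rewrite mem_moves => eA /ext_insert[B [j [dB eB]]].
have AB : is_ext_edge (A, B, i, e).
  by apply/existsP; exists j; rewrite /ext_move dB eqxx edge_fromE eA eB eqxx.
by exists (exist _ (A, B, i, e) AB).
Qed.

Lemma ext_edge_finite A :
  finite_set [set x | @source _ _ (ext_power G n) x = A]%classic.
Proof.
rewrite -(eq_finite_set (inj_card_eq (f := move_of) _)).
  apply: (@sub_finite_set _ _ [set` moves A]%classic); last first.
    by apply/finite_seqP; exists (moves A).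
  move=> _ [x <- <-] /=; case: (ext_edgeP x) => j [_ + _ _].
  by rewrite -mem_moves.
move=> x y; rewrite !inE => xA yA; apply: (@move_of_inj A); exact/eqP.
Qed.

Variable ext_outs : seq (ext_edge G n).

Lemma det_series_ext A :
  uniq ext_outs ->
  (forall x, (x \in ext_outs) = (@source _ _ (ext_power G n) x == A)) ->
  expseries_deriv (det_series A) = \sum_(x <- ext_outs)
    expseries_const (ext_weight x) * det_series (@target _ _ (ext_power G n) x).
Proof.
move=> ux mx; rewrite det_series_deriv.
(* Colliding moves contribute zero; the others correspond bijectively to the edges out of [A],
   through [move_of]. *)
rewrite -(big_rmcond_in
  (fun p => other_end (entry p.1 A) p.2 \notin del_entry p.1 A)); last first.
  by move=> p _ /negPn /det_series_at_collision ->; rewrite mulr0.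
rewrite -big_filter (perm_big (map move_of ext_outs)) /=.
  rewrite big_map; apply: eq_big_seq => x; rewrite mx => /eqP xA.
  have [j] := ext_edgeP x; rewrite xA => -[dAB _ eB ->].
  (* The sign from reordering the rows is exactly the one carried by [ext_weight x]. *)
  rewrite /det_series_at eB (det_ext_move f dAB) mulrCA mulrA.
  by rewrite expseries_const_sign.
apply: uniq_perm; first by rewrite filter_uniq ?moves_uniq.
  rewrite map_inj_in_uniq // => x y; rewrite !mx; exact: move_of_inj.
move=> p; rewrite mem_filter; apply/andP/mapP => [[pA /ext_edge_of_move]|[x]].
  by case=> // x xA <-; exists x; rewrite // mx xA.
rewrite mx => /eqP xA ->; have [j] := ext_edgeP x; rewrite xA.
move=> [dAB eA eB _]; split; last by rewrite mem_moves.
by rewrite eB dAB mem_del_entry eqxx.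
Qed.

End ExtWalks.

(** * Comparison of the coefficients of both sides *)

(** All edges of the exterior power are directed, so the second disjunct of [edge_out] computes to
    false. *)
Lemma ext_edge_outE (R : comPzRingType) (d : Order.disp_t) (V : orderType d)
    (G : wgraph R V) (n : nat) (A : ext_vertex V n) (x : edge (ext_power G n)) :
  (x \in edge_out A) = (source x == A).
Proof. exact: orbF. Qed.

Lemma finite_set_uniq (T : choiceType) (A : set T) : finite_set A ->
  exists s : seq T, uniq s /\ (forall x, x \in s <-> A x).
Proof.
move=> /finite_seqP[s ->]; exists (undup s); split; first exact: undup_uniq.
by move=> x; rewrite mem_undup.
Qed.

Theorem theorem21 (R : comPzRingType) (d : Order.disp_t) (V : orderType d)
    (G : wgraph R V) (hG : locally_finite G) (n : nat) (hn : (0 < n)%N)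
    (u v : ext_vertex V n) :
  walk_series (ext_power G n) u v =
  \det (\matrix_(i < n, j < n) walk_series G (entry i u) (entry j v)).
Proof.
have /choice[outs outsP] : forall x, exists s : seq (edge G),
    uniq s /\ s =i edge_out x.
  move=> x.
  have [|s [us sx]] := @finite_set_uniq _ [set` @edge_out _ _ G x]%classic.
    by apply: sub_finite_set (hG x) => e /orP[/eqP|/andP[_ /eqP]]; [left|right].
  by exists s; split=> // e; apply/idP/idP => /sx.
have outs_uniq x := (outsP x).1; have mem_outs x := (outsP x).2.
have /choice[outsE outsEP] : forall A, exists s : seq (edge (ext_power G n)),
    uniq s /\ s =i edge_out A.
  move=> A; have [s [us sx]] := finite_set_uniq (ext_edge_finite mem_outs A).
  by exists s; split=> // x; rewrite ext_edge_outE; apply/idP/eqP => /sx.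
have outsE_uniq A := (outsEP A).1; have mem_outsE A := (outsEP A).2.
(* The start [u] is generalized because a first step changes it; [v] stays fixed. *)
apply/funext => m; elim: m u => [|m IH] u.
  (* Taking constant terms inside the determinant leaves a matrix of Kronecker deltas. *)
  rewrite (walk_series0 outsE_uniq mem_outsE) -[RHS]/(expseries_coef0 _).
  rewrite -det_map_mx -(det_delta R u v); congr (\det _); apply/matrixP => k l.
  by rewrite !mxE [RHS](walk_series0 outs_uniq mem_outs).
rewrite -[LHS]/(expseries_deriv _ m) (walk_series_out outsE_uniq mem_outsE).
rewrite -[RHS]/(expseries_deriv (det_series G v u) m).
rewrite (det_series_ext v outs_uniq mem_outs (outsE_uniq u)); last first.
  by move=> x; rewrite mem_outsE ext_edge_outE.
rewrite !expseries_sumE; apply: eq_big_seq => x; rewrite mem_outsE ext_edge_outE => xu.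
by rewrite !expseries_constM IH /other_end xu.
Qed.
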